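(* Let $\mathcal{A}$ be an infinite set with a height function, let $\mathcal{A}(N)$ be the finite set of its elements of height at most $N$, and assume $\log|\mathcal{A}(N)|\asymp\log N$. For each prime $p$ let $f_p:\mathcal{A}\to\{-1,0,1\}$. Suppose there exist $\xi>0$ and multiplicative functions $\eta_+,\eta_-$ with values in $[0,1]$ such that for every pair of coprime positive squarefree integers $q_-,q_+$ with $q_-q_+\le N^{\xi/2}$, $$\frac{1}{|\mathcal{A}(N)|}\left|\left\{x\in\mathcal{A}(N): p\mid q_-\Rightarrow f_p(x)=-1,\ p\mid q_+\Rightarrow f_p(x)=1\right\}\right|=\eta_-(q_-)\eta_+(q_+)+O(N^{-\xi}),$$ and there are constants $c_+,c_-,C>0$ and $M_+,M_-$ such that, uniformly for all $N\ge2$: $\eta_\pm(p)\ll1/p$; $\sum_{p\le N}\eta_\pm(p)=c_\pm\log\log N+M_\pm+O(1/\log N)$; and $\max_{x\in\mathcal{A}(N)}\prod_{p:\,f_p(x)\ne0}p\ll N^C$. Then for every $A_0>0$ there exists $\delta(A_0)>0$ such that $$\left|\left\{x\in\mathcal{A}(N):\sum_pf_p(x)\ge A_0\log\log N\right\}\right|\gg_{A_0}|\mathcal{A}(N)|(\log N)^{-\delta(A_0)}$$ for all $N\ge2$.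
   Formalization: The lower bound is proved for all N at least some N_0 depending on A_0 and the data, not for all N ≥ 2; for small N the literal claim fails, since no element of A(N) need have sum of f_p(x) as large as A_0 log log N. *)

(* Defs.v *)
From mathcomp Require Import all_boot all_order all_algebra.
From mathcomp Require Import all_classical all_reals all_analysis.
Set Implicit Arguments. Unset Strict Implicit. Unset Printing Implicit Defensive.
Import Order.TTheory GRing.Theory Num.Theory.
Local Open Scope ring_scope.

Definition squarefree (q : nat) : Prop :=
  (0 < q)%N /\ forall d : nat, (1 < d)%N -> ~ (d * d %| q)%N.

Definition mult01 {R : realType} (eta : nat -> R) : Prop :=
  eta 1%N = 1 /\
  (forall m n : nat, coprime m n -> eta (m * n)%N = eta m * eta n) /\
  (forall n : nat, 0 <= eta n <= 1).

Definition psum {R : realType} (g : nat -> R) (N : R) : R :=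
  \sum_(p < (Num.truncn N).+1 | prime p) g p.

Definition fpartial {R : realType} {A : Type} (f : nat -> A -> int) (x : A)
  (n : nat) : R :=
  \sum_(p < n | prime p) (f p x)%:~R.

(* "\sum_p f_p(x) >= t": the (eventually constant, since f_p(x) has finite
   support under the hypotheses) partial sums over primes are eventually >= t *)
Definition fsum_ge {R : realType} {A : Type} (f : nat -> A -> int) (x : A)
  (t : R) : Prop :=
  exists n0 : nat, forall n : nat, (n0 <= n)%N -> t <= fpartial f x n.

Definition count_sieve {A : Type} (f : nat -> A -> int) (s : seq A)
  (qm qp : nat) : nat :=
  count (fun x => all (fun p => f p x == -1) (primes qm)
               && all (fun p => f p x == 1) (primes qp)) s.

(* Main.v *)
Require Import Defs.
From mathcomp Require Import all_boot all_order all_algebra.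
From mathcomp Require Import all_classical all_reals all_analysis.
From mathcomp Require Import ring lra.
Set Implicit Arguments. Unset Strict Implicit. Unset Printing Implicit Defensive.
Import Order.TTheory GRing.Theory Num.Theory.
Local Open Scope ring_scope.

(* Write L = log log N and let x be uniform in A(N).  For a large multiple
   k = B L of L, choose k disjoint blocks of primes, each filling an interval of
   the same length for log log p inside [L / 4, L / 2], and let X be the number
   of transversals of the blocks on which f = 1.  A product of two transversals
   is a small power of N, so that the first two moments of X are, up to a
   negligible error, those of the independent model: with S_i the sum of eta_+
   over the i-th block, E X is about prod S_i and E X^2 is at most about
   prod S_i (1 + S_i).  Hence X > 0, which forces f_p = 1 for at least k primes,
   with probability at least 1/8 prod S_i / (1 + S_i); by Mertens' estimate the
   S_i are bounded below, and this is at least exp (- delta L).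
   If M counts the primes p <= N^(xi/4) with f_p = -1, then E (X M) is about
   E X * E M, and weighting X by 1 - M / m for m a constant multiple of L gives
   M < m on the same event.  By the bound on the support, beyond N^(xi/4) there
   are at most L primes with f_p <> 0. *)

(** * Finite products and sums *)

Lemma prod_primes_gt0 (r : seq nat) :
  all prime r -> (0 < \prod_(p <- r) p)%N.
Proof.
move=> /allP rP; rewrite big_seq_cond prodn_cond_gt0 // => p.
by case/andP=> /rP/prime_gt0.
Qed.

Lemma prime_dvd_prod_primes (r : seq nat) (p : nat) :
  all prime r -> prime p -> (p %| \prod_(q <- r) q)%N = (p \in r).
Proof.
move=> /allP rP pP; rewrite Euclid_dvd_prod // big_has -has_pred1.
by apply: eq_in_has => q /rP qP /=; rewrite dvdn_prime2 // eq_sym.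
Qed.

Lemma primes_prod_primes (r : seq nat) :
  all prime r -> primes (\prod_(p <- r) p)%N =i r.
Proof.
move=> rP p; rewrite mem_primes prod_primes_gt0 //=.
have [pP|pN] := boolP (prime p); first by rewrite prime_dvd_prod_primes.
by apply/esym/negP => /(allP rP); apply/negP.
Qed.

Lemma coprime_prod_primes (r1 r2 : seq nat) :
  all prime r1 -> all prime r2 ->
  coprime (\prod_(p <- r1) p)%N (\prod_(p <- r2) p)%N = ~~ has [in r1] r2.
Proof.
move=> r1P r2P; rewrite coprime_has_primes ?prod_primes_gt0 //.
rewrite (eq_has_r (primes_prod_primes r2P)).
by rewrite (eq_has (primes_prod_primes r1P)).
Qed.

Lemma squarefree_prod_primes (r : seq nat) :
  uniq r -> all prime r -> squarefree (\prod_(p <- r) p)%N.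
Proof.
move=> r_uniq rP; split=> [|d d_gt1 sqr_dvd]; first exact: prod_primes_gt0.
have pP := pdiv_prime d_gt1; set p := pdiv d in pP.
have sqrp_dvd : (p * p %| \prod_(q <- r) q)%N.
  by apply: dvdn_trans sqr_dvd; apply: dvdn_mul; apply: pdiv_dvd.
have p_in_r : p \in r.
  rewrite -prime_dvd_prod_primes //.
  by apply: dvdn_trans sqrp_dvd; apply: dvdn_mulr.
have rem_prime : all prime (rem p r) by apply/allP => q /mem_rem /(allP rP).
move: sqrp_dvd; rewrite (big_rem p p_in_r) /= dvdn_pmul2l ?prime_gt0 //.
by rewrite prime_dvd_prod_primes // mem_rem_uniqF.
Qed.

Lemma mult01_prod_primes {R : realType} (eta : nat -> R) (r : seq nat) :
  mult01 eta -> uniq r -> all prime r ->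
  eta (\prod_(p <- r) p)%N = \prod_(p <- r) eta p.
Proof.
case=> eta1 [etaM _]; elim: r => [|p r IH] /=; first by rewrite !big_nil.
case/andP=> p_notin_r r_uniq /andP[pP rP]; rewrite !big_cons etaM ?IH //.
by rewrite prime_coprime // prime_dvd_prod_primes.
Qed.

Lemma mult01_ge0 {R : realType} (eta : nat -> R) (q : nat) :
  mult01 eta -> 0 <= eta q.
Proof. by case=> _ [_ /(_ q)/andP[]]. Qed.

Lemma prod_seq_leq_exp (r : seq nat) (n : nat) :
  all (leq^~ n) r -> (\prod_(p <- r) p <= n ^ size r)%N.
Proof.
elim: r => [|p r IH] /=; first by rewrite big_nil.
by case/andP=> pn /IH rn; rewrite big_cons expnS leq_mul.
Qed.

Lemma sum_ord_itv {V : zmodType} (a b n : nat) (B : pred nat) (g : nat -> V) :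
  (a <= b <= n)%N ->
  \sum_(p < n | B p && (a <= p < b)%N) g p =
    \sum_(p < b | B p) g p - \sum_(p < a | B p) g p.
Proof.
move=> /andP[ab bn]; rewrite (big_ord_widen_cond _ B g bn).
rewrite (big_ord_widen_cond _ B g (leq_trans ab bn)).
apply/eqP; rewrite eq_sym subr_eq addrC.
rewrite (bigID (fun p : 'I_n => (p < a)%N)) /=.
apply/eqP; congr (_ + _); apply: eq_bigl => p; rewrite -andbA.
  by case: (ltnP p a) => [/leq_trans->|]; rewrite ?andbF.
by rewrite -leqNgt [(p < b)%N && _]andbC.
Qed.

Lemma exprn_le_prod {R : numDomainType} (a : R) (k : nat) (F : 'I_k -> R) :
  0 <= a -> (forall i, a <= F i) -> a ^+ k <= \prod_(i < k) F i.
Proof.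
move=> a_ge0 a_le_F; rewrite -[k in leLHS]card_ord -prodr_const.
by apply: ler_prod => i _; rewrite a_ge0 a_le_F.
Qed.

(** * Means and the second moment method *)

Section Mean.
Context {R : realType} {A : Type} (s : seq A).
Implicit Types F G : A -> R.

(* The mean over an empty sequence is 0. *)
Definition mean F : R := (\sum_(x <- s) F x) / (size s)%:R.

Lemma eq_mean F G : F =1 G -> mean F = mean G.
Proof. by move=> FG; rewrite /mean (eq_bigr _ (fun x _ => FG x)). Qed.

Lemma le_mean F G : (forall x, F x <= G x) -> mean F <= mean G.
Proof. by move=> FG; rewrite ler_wpM2r ?invr_ge0 // ler_sum. Qed.

Lemma mean_sum (I : finType) (Q : pred I) (F : I -> A -> R) :
  mean (fun x => \sum_(i | Q i) F i x) = \sum_(i | Q i) mean (F i).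
Proof. by rewrite /mean exchange_big /= mulr_suml. Qed.

Lemma meanZ (a : R) F : mean (fun x => a * F x) = a * mean F.
Proof. by rewrite /mean -mulr_sumr mulrA. Qed.

Lemma meanB F G : mean (fun x => F x - G x) = mean F - mean G.
Proof. by rewrite /mean sumrB mulrBl. Qed.

Lemma mean_pred (B : pred A) :
  mean (fun x => (B x)%:R) = (count B s)%:R / (size s)%:R.
Proof.
rewrite /mean -sum1_count natr_sum [in RHS]big_mkcond; congr (_ / _).
by apply: eq_bigr => x _; case: (B x).
Qed.

Lemma mulr_size_mean_pred (B : pred A) :
  (size s)%:R * mean (fun x => (B x)%:R) = (count B s)%:R.
Proof.
rewrite mean_pred; have [size_eq0|size_gt0] := posnP (size s).
  have /eqP -> : count B s == 0%N by rewrite -leqn0 -size_eq0 count_size.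
  by rewrite mul0r mulr0.
by rewrite mulrCA divff ?mulr1 // pnatr_eq0 -lt0n.
Qed.

Lemma le_mean_pred (B1 B2 : pred A) : subpred B1 B2 ->
  mean (fun x => (B1 x)%:R) <= mean (fun x => (B2 x)%:R).
Proof.
move=> B12; apply: le_mean => x; rewrite ler_nat.
by case: (B1 x) (B12 x) => // ->.
Qed.

Lemma cauchy_schwarz_mean_pred F (B : pred A) (V : R) :
  0 < V -> mean (fun x => F x ^+ 2) <= V ->
  mean (fun x => F x * (B x)%:R) ^+ 2 / V <= mean (fun x => (B x)%:R).
Proof.
move=> V_gt0 sqrF_le; set E := mean (fun x => F x * _); set t := E / V.
have pointwise x : 2 * t * (F x * (B x)%:R) - t ^+ 2 * F x ^+ 2 <= (B x)%:R.
  have := sqr_ge0 (t * F x - 1); have := sqr_ge0 (t * F x).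
  rewrite sqrrB1 exprMn; case: (B x) => /=; lra.
have := le_mean pointwise; rewrite meanB !meanZ -/E.
apply: le_trans.
have -> : E ^+ 2 / V = 2 * t * E - t ^+ 2 * V.
  by rewrite /t; field; rewrite gt_eqF.
by rewrite lerB // ler_wpM2l // sqr_ge0.
Qed.

(* X (1 - M / m) is at most X, and it is nonpositive where m <= M. *)
Lemma second_moment_mean (X M : A -> R) (m E V : R) :
  (forall x, 0 <= X x) -> (forall x, 0 <= M x) -> 0 < m -> 0 <= E -> 0 < V ->
  E <= mean (fun x => X x * (1 - M x / m)) ->
  mean (fun x => X x ^+ 2) <= V ->
  E ^+ 2 / V <= mean (fun x => ((0 < X x) && (M x < m))%:R).
Proof.
move=> X_ge0 M_ge0 m_gt0 E_ge0 V_gt0 E_le sqrX_le.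
apply: le_trans (cauchy_schwarz_mean_pred _ V_gt0 sqrX_le).
set Y := mean (fun x => X x * _).
suff E_le_Y : E <= Y.
  rewrite ler_wpM2r ?invr_ge0 ?(ltW V_gt0) // ler_sqr ?nnegrE //.
  exact: le_trans E_le_Y.
apply: le_trans E_le _; apply: le_mean => x.
have := X_ge0 x; rewrite le_eqVlt => /predU1P[<-|Xx_gt0].
  by rewrite !mul0r.
rewrite Xx_gt0 ler_pM2l //=; case: ltP => Mx_lt_m.
  by rewrite gerBl divr_ge0 // ltW.
by rewrite subr_le0 ler_pdivlMr // mul1r.
Qed.

End Mean.

Lemma le_mean_pred_in {R : realType} {A : eqType} (s : seq A) (B1 B2 : pred A) :
  {in s, subpred B1 B2} ->
  mean s (fun x => (B1 x)%:R) <= mean s (fun x => (B2 x)%:R) :> R.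
Proof.
move=> B12; have B1E : {in s, B1 =1 predI B1 B2}.
  by move=> x /B12 /=; case: (B1 x) => // ->.
rewrite mean_pred (eq_in_count B1E) -mean_pred.
by apply: le_mean_pred => x /andP[].
Qed.

(** * Moments of the number of transversals *)

Definition value_ind {R : realType} {A : Type} (f : nat -> A -> int) (e : int)
  (x : A) (p : nat) : R := (f p x == e)%:R.

Definition value_count {R : realType} {A : Type} (f : nat -> A -> int) (e : int)
  (x : A) (n : nat) : R := \sum_(p < n | prime p) value_ind f e x p.

Definition large_support {A : Type} (f : nat -> A -> int) (x : A) (z n : nat) :
  {set 'I_n} := [set p : 'I_n | [&& prime p, f p x != 0 & (z <= p)%N]].

Definition support_prod {A : Type} (f : nat -> A -> int) (x : A) (n : nat) :
  nat := \prod_(p < n | prime p && (f p x != 0)) p.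

Definition equidistributed {R : realType} {A : Type} (f : nat -> A -> int)
  (s : seq A) (eta_m eta_p : nat -> R) (Q eps : R) : Prop :=
  forall qm qp : nat, squarefree qm -> squarefree qp -> coprime qm qp ->
    (qm * qp)%N%:R <= Q ->
    `| (count_sieve f s qm qp)%:R / (size s)%:R - eta_m qm * eta_p qp | <= eps.

Definition prime_blocks (k n : nat) (P : 'I_k -> pred 'I_n) : Prop :=
  (forall i p, P i p -> prime p) /\ (forall i j p, P i p -> P j p -> i = j).

Definition block_sum {R : realType} (g : nat -> R) (k n : nat)
  (P : 'I_k -> pred 'I_n) (i : 'I_k) : R := \sum_(p < n | P i p) g p.

(* The number of transversals of the blocks on which f is identically 1. *)
Definition block_hits {R : realType} {A : Type} (f : nat -> A -> int)
  (k n : nat) (P : 'I_k -> pred 'I_n) (x : A) : R :=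
  \prod_(i < k) block_sum (value_ind f 1 x) P i.

Section ValueIndicator.
Context {R : realType} {A : Type} (f : nat -> A -> int).

Lemma prod_value_ind (e : int) (x : A) (r : seq nat) :
  \prod_(p <- r) value_ind f e x p = (all (fun p => f p x == e) r)%:R :> R.
Proof.
elim: r => [|p r IH] /=; first by rewrite big_nil.
by rewrite big_cons IH -natrM mulnb.
Qed.

Lemma value_ind_idem (e : int) (x : A) (p : nat) :
  value_ind f e x p * value_ind f e x p = value_ind f e x p :> R.
Proof. by rewrite -natrM mulnb andbb. Qed.

Lemma value_ind_disjoint (e e' : int) (x : A) (p : nat) :
  e != e' -> value_ind f e x p * value_ind f e' x p = 0 :> R.
Proof.
rewrite -natrM mulnb /value_ind => ee'.
by case: (f p x =P e) => [->|_] //=; rewrite (negbTE ee').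
Qed.

Lemma block_hits_transversals (k n : nat) (P : 'I_k -> pred 'I_n) (x : A) :
  block_hits f P x =
    \sum_(t in family P) \prod_(i < k) value_ind f 1 x (t i) :> R.
Proof. exact: bigA_distr_big_dep. Qed.

Lemma block_hits_ge0 (k n : nat) (P : 'I_k -> pred 'I_n) (x : A) :
  0 <= block_hits f P x :> R.
Proof. by apply: prodr_ge0 => i _; apply: sumr_ge0. Qed.

End ValueIndicator.

Lemma equidistributed_mean {R : realType} {A : Type} (f : nat -> A -> int)
  (s : seq A) (eta_m eta_p : nat -> R) (Q eps : R) (rm rp : seq nat) :
  mult01 eta_m -> mult01 eta_p -> equidistributed f s eta_m eta_p Q eps ->
  uniq (rm ++ rp) -> all prime (rm ++ rp) ->
  (\prod_(p <- rm ++ rp) p)%N%:R <= Q ->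
  `| mean s (fun x => (\prod_(p <- rm) value_ind f (-1) x p) *
                      \prod_(p <- rp) value_ind f 1 x p)
     - (\prod_(p <- rm) eta_m p) * \prod_(p <- rp) eta_p p | <= eps.
Proof.
move=> m_mult p_mult equi; rewrite cat_uniq all_cat big_cat /=.
case/and3P=> rm_uniq rm_rp_disjoint rp_uniq /andP[rm_prime rp_prime] prod_le.
have := equi _ _ (squarefree_prod_primes rm_uniq rm_prime)
  (squarefree_prod_primes rp_uniq rp_prime).
rewrite coprime_prod_primes // !mult01_prod_primes //.
move=> /(_ rm_rp_disjoint prod_le).
under eq_mean => x do rewrite !prod_value_ind -natrM mulnb.
rewrite mean_pred /count_sieve.
under eq_count => x.
  rewrite (eq_all_r (primes_prod_primes rm_prime)).
  rewrite (eq_all_r (primes_prod_primes rp_prime)).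
  over.
by [].
Qed.

Lemma equidistributed_ge0 {R : realType} {A : Type} (f : nat -> A -> int)
  (s : seq A) (eta_m eta_p : nat -> R) (Q eps : R) :
  equidistributed f s eta_m eta_p Q eps -> 1 <= Q -> 0 <= eps.
Proof.
have squarefree1 : squarefree 1.
  by split=> // d d_gt1; rewrite dvdn1 muln_eq1; case: d d_gt1 => [|[|]].
move=> equi Q_ge1.
exact: le_trans (normr_ge0 _) (equi _ _ squarefree1 squarefree1 isT Q_ge1).
Qed.

Section Transversals.
Context {k n : nat} (P : 'I_k -> pred 'I_n).
Hypothesis P_blocks : prime_blocks P.
Implicit Types t u : {ffun 'I_k -> 'I_n}.

Definition transversal_seq t : seq nat :=
  [seq val (t i) | i <- index_enum 'I_k].

Lemma transversal_inj t : t \in family P -> injective t.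
Proof.
move=> /familyP tP i j eq_tij; have [_ disj] := P_blocks.
by apply: (disj i j (t i)); [exact: tP | rewrite eq_tij; exact: tP].
Qed.

Lemma transversal_uniq t : t \in family P -> uniq (transversal_seq t).
Proof.
move=> tP; rewrite map_inj_uniq ?index_enum_uniq // => i j /val_inj.
exact: transversal_inj.
Qed.

Lemma transversal_prime t : t \in family P -> all prime (transversal_seq t).
Proof.
move=> /familyP tP; have [P_prime _] := P_blocks; rewrite all_map.
by apply/allP => i _ /=; apply: P_prime (tP i).
Qed.

Lemma prod_sub_transversal_le t (r : seq 'I_k) : subseq r (index_enum 'I_k) ->
  (\prod_(p <- [seq val (t i) | i <- r]) p <= n ^ k)%N.
Proof.
move=> /size_subseq; have -> : size (index_enum 'I_k) = k.
  by rewrite -[RHS]size_enum_ord enumT.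
move=> size_le.
case: r => [|i r] in size_le *.
  rewrite big_nil expn_gt0; have [_|k_gt0] := posnP k; first by rewrite orbT.
  by rewrite (leq_ltn_trans _ (ltn_ord (t (Ordinal k_gt0)))).
have n_gt0 : (0 < n)%N by apply: leq_ltn_trans (ltn_ord (t i)).
apply: leq_trans (_ : n ^ size (i :: r) <= _)%N; last by rewrite leq_pexp2l.
rewrite -(size_map (fun i => val (t i))); apply: prod_seq_leq_exp.
by rewrite all_map; apply/allP => j _ /=; apply: ltnW.
Qed.

Lemma prod_transversal_le t : (\prod_(p <- transversal_seq t) p <= n ^ k)%N.
Proof. exact: prod_sub_transversal_le. Qed.

Definition transversal_diff t u : seq nat :=
  [seq val (u i) | i <- [seq i <- index_enum 'I_k | u i != t i]].

Lemma transversal_diff_subseq t u :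
  subseq (transversal_diff t u) (transversal_seq u).
Proof. by rewrite map_subseq ?filter_subseq. Qed.

Lemma prod_transversal_diff_le t u :
  (\prod_(p <- transversal_diff t u) p <= n ^ k)%N.
Proof. exact/prod_sub_transversal_le/filter_subseq. Qed.

Lemma transversal_cat_diff_prime t u : t \in family P -> u \in family P ->
  all prime (transversal_seq t ++ transversal_diff t u).
Proof.
move=> tP uP; rewrite all_cat transversal_prime //.
apply/allP => p /(mem_subseq (transversal_diff_subseq t u)).
exact/(allP (transversal_prime uP)).
Qed.

Lemma transversal_cat_diff_uniq t u : t \in family P -> u \in family P ->
  uniq (transversal_seq t ++ transversal_diff t u).
Proof.
move=> tP uP; rewrite cat_uniq transversal_uniq //=.
rewrite (subseq_uniq (transversal_diff_subseq t u) (transversal_uniq uP)) andbT.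
apply/hasPn => _ /mapP[j + ->]; rewrite mem_filter => /andP[ujt _].
apply: contra ujt => /mapP[i _ /val_inj ujti]; rewrite ujti.
have [_ disj] := P_blocks; move/familyP: tP => tP; move/familyP: uP => uP.
by rewrite (disj i j (t i) (tP i)) // -ujti; apply: uP.
Qed.

Lemma prod_transversal_cat_diff {R : comNzRingType} (g : nat -> R) t u :
  \prod_(p <- transversal_seq t ++ transversal_diff t u) g p =
    \prod_i (g (t i) * if u i != t i then g (u i) else 1).
Proof.
by rewrite big_cat /= !big_map big_filter [X in _ * X]big_mkcond -big_split.
Qed.

Lemma card_transversals_le : (#|[pred t in family P]| <= n ^ k)%N.
Proof. by apply: leq_trans (max_card _) _; rewrite card_ffun !card_ord. Qed.

End Transversals.

Section TransversalMeans.
Context {R : realType} {A : Type} (f : nat -> A -> int) (s : seq A).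
Variables (eta_m eta_p : nat -> R) (Q eps : R).
Hypotheses (eta_m_mult : mult01 eta_m) (eta_p_mult : mult01 eta_p).
Hypotheses (equi : equidistributed f s eta_m eta_p Q eps) (eps_ge0 : 0 <= eps).
Context {k n : nat} (P : 'I_k -> pred 'I_n).
Hypothesis P_blocks : prime_blocks P.
Implicit Types t u : {ffun 'I_k -> 'I_n}.

Let eta_m_ge0 p : 0 <= eta_m p. Proof. exact: mult01_ge0. Qed.
Let eta_p_ge0 p : 0 <= eta_p p. Proof. exact: mult01_ge0. Qed.

Lemma mean_transversal_dist_le t : t \in family P -> (n ^ k)%N%:R <= Q ->
  `| mean s (fun x => \prod_i value_ind f 1 x (t i)) - \prod_i eta_p (t i) |
    <= eps.
Proof.
move=> tP nk_le; have prod_le : (\prod_(p <- transversal_seq t) p)%N%:R <= Q.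
  by apply: le_trans nk_le; rewrite ler_nat prod_transversal_le.
have := equidistributed_mean (rm := [::]) eta_m_mult eta_p_mult equi
  (transversal_uniq P_blocks tP) (transversal_prime P_blocks tP) prod_le.
under eq_mean => x do rewrite big_nil mul1r big_map.
by rewrite big_nil mul1r big_map.
Qed.

Lemma mean_transversal_minus_le t (p z : nat) :
  t \in family P -> prime p -> (p < z)%N -> (n ^ k * z)%N%:R <= Q ->
  mean s (fun x => (\prod_i value_ind f 1 x (t i)) * value_ind f (-1) x p)
    <= (\prod_i eta_p (t i)) * eta_m p + eps.
Proof.
move=> tP p_prime p_lt_z nkz_le.
have [/mapP[i _ ->]|p_notin_t] := boolP (p \in transversal_seq t).
  under eq_mean => x.
    rewrite (bigD1 i) //= mulrAC value_ind_disjoint // mul0r.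
    over.
  by rewrite /mean big1 // mul0r addr_ge0 ?mulr_ge0 ?prodr_ge0 ?eta_m_ge0.
have := equidistributed_mean (rm := [:: p]) (rp := transversal_seq t)
  eta_m_mult eta_p_mult equi.
rewrite /= p_prime p_notin_t (transversal_uniq P_blocks tP).
rewrite (transversal_prime P_blocks tP).
under eq_mean => x do rewrite big_seq1 big_map mulrC.
rewrite big_seq1 big_map [eta_m p * _]mulrC => /(_ isT isT) sieve.
rewrite -lerBlDl; apply: le_trans (ler_norm _) (sieve _).
apply: le_trans nkz_le; rewrite big_cons ler_nat mulnC.
by rewrite leq_mul ?prod_transversal_le // ltnW.
Qed.

(* Where t and u agree the two indicators coincide, so that only the primes of
   transversal_diff t u contribute a second factor. *)
Lemma mean_transversal_pair_le t u :
  t \in family P -> u \in family P -> (n ^ k * n ^ k)%N%:R <= Q ->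
  mean s (fun x => (\prod_i value_ind f 1 x (t i)) *
                   \prod_i value_ind f 1 x (u i))
    <= \prod_i (eta_p (t i) * ((u i == t i)%:R + eta_p (u i))) + eps.
Proof.
move=> tP uP nknk_le; pose r := transversal_seq t ++ transversal_diff t u.
have prod_le : (\prod_(p <- r) p)%N%:R <= Q.
  apply: le_trans nknk_le; rewrite ler_nat big_cat.
  exact: leq_mul (prod_transversal_le t) (prod_transversal_diff_le t u).
have := equidistributed_mean (rm := [::]) eta_m_mult eta_p_mult equi
  (transversal_cat_diff_uniq P_blocks tP uP)
  (transversal_cat_diff_prime P_blocks tP uP) prod_le.
under eq_mean => x do rewrite big_nil mul1r prod_transversal_cat_diff.
rewrite big_nil mul1r prod_transversal_cat_diff => /(le_trans (ler_norm _)).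
rewrite lerBlDl.
under eq_mean => x.
  rewrite (eq_bigr (fun i => value_ind f 1 x (t i) * value_ind f 1 x (u i))).
    rewrite big_split.
    over.
  by move=> i _; case: eqP => //= ->; rewrite mulr1 value_ind_idem.
move=> /le_trans; apply; rewrite lerD2r; apply: ler_prod => i _.
rewrite mulr_ge0 //=; last by case: ifP.
by rewrite ler_wpM2l //; case: eqP => _ /=; have := eta_p_ge0 (u i); lra.
Qed.

Lemma sum_transversals_le (F G : {ffun 'I_k -> 'I_n} -> R) (N : nat) :
  (forall t, t \in family P -> F t <= G t + N%:R * eps) ->
  (n ^ k * N)%N%:R <= Q ->
  \sum_(t in family P) F t <= \sum_(t in family P) G t + Q * eps.
Proof.
move=> F_le_G nkN_le; apply: le_trans (ler_sum _ F_le_G) _.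
rewrite big_split lerD2l /=.
rewrite sumr_const -[leLHS]mulr_natl mulrA -natrM ler_wpM2r //.
by apply: le_trans nkN_le; rewrite ler_nat leq_mul ?card_transversals_le.
Qed.

Lemma mean_block_hits_ge : (n ^ k)%N%:R <= Q ->
  \prod_(i < k) block_sum eta_p P i - Q * eps
    <= mean s (block_hits f P).
Proof.
move=> nk_le; under eq_mean => x do rewrite block_hits_transversals.
rewrite mean_sum lerBlDr bigA_distr_big_dep.
apply: (@sum_transversals_le _ _ 1); last by rewrite muln1.
move=> t tP; have := mean_transversal_dist_le tP nk_le.
by rewrite mul1r ler_norml => /andP[+ _]; lra.
Qed.

Lemma mean_block_hits_minus_le (z : nat) : (n ^ k * z)%N%:R <= Q ->
  mean s (fun x => block_hits f P x * value_count f (-1) x z)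
    <= (\prod_(i < k) block_sum eta_p P i) *
       (\sum_(p < z | prime p) eta_m p) + Q * eps.
Proof.
move=> nkz_le.
under eq_mean => x do rewrite block_hits_transversals mulr_suml.
rewrite mean_sum bigA_distr_big_dep mulr_suml.
apply: sum_transversals_le (nkz_le).
move=> t tP; under eq_mean => x do rewrite mulr_sumr.
rewrite mean_sum mulr_sumr; apply: le_trans (ler_sum _ _) _ => [p p_prime|].
  exact: mean_transversal_minus_le tP p_prime (ltn_ord p) nkz_le.
rewrite big_split lerD2l /= sumr_const -[leLHS]mulr_natl ler_wpM2r // ler_nat.
by rewrite -[X in (_ <= X)%N]card_ord max_card.
Qed.

Lemma mean_sqr_block_hits_le : (n ^ k * n ^ k)%N%:R <= Q ->
  mean s (fun x => block_hits f P x ^+ 2)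
    <= (\prod_(i < k) block_sum eta_p P i) *
       \prod_(i < k) (1 + block_sum eta_p P i) + Q * eps.
Proof.
move=> nknk_le; set W := \prod_i (1 + _).
under eq_mean => x.
  rewrite expr2 [X in X * _]block_hits_transversals mulr_suml.
  over.
rewrite mean_sum bigA_distr_big_dep mulr_suml.
apply: sum_transversals_le (nknk_le).
move=> t tP; under eq_mean => x do rewrite block_hits_transversals mulr_sumr.
rewrite mean_sum; apply: le_trans (ler_sum _ _) _ => [u uP|].
  exact: mean_transversal_pair_le tP uP nknk_le.
rewrite big_split /= lerD //; last first.
  rewrite sumr_const -[leLHS]mulr_natl ler_wpM2r // ler_nat.
  exact: card_transversals_le.
rewrite -(bigA_distr_big_dep P
  (fun i p => eta_p (t i) * ((p == t i)%:R + eta_p p))).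
rewrite [leLHS](eq_bigr (fun i =>
  eta_p (t i) * (1 + block_sum eta_p P i))) ?big_split // => i _.
rewrite -mulr_sumr big_split /=; congr (_ * (_ + _)).
rewrite (bigD1 (t i)) /=; last by move/familyP: tP; apply.
by rewrite eqxx big1 ?addr0 // => p /andP[_ /negbTE ->].
Qed.

(* With H and W the products of S_i and 1 + S_i, S_i the block sums, the mean of
   block_hits * (1 - value_count / m) is at least H / 2 and that of block_hits^2
   at most 2 H W. *)
Lemma mean_block_hits_few_minus (m : R) (z : nat) :
  (forall i, 0 < block_sum eta_p P i) ->
  1 <= m -> 4 * \sum_(p < z | prime p) eta_m p <= m ->
  (0 < z)%N -> (n ^ k * n ^ k)%N%:R <= Q -> (n ^ k * z)%N%:R <= Q ->
  8 * (Q * eps) <= \prod_(i < k) block_sum eta_p P i ->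
  8^-1 * \prod_(i < k) (block_sum eta_p P i / (1 + block_sum eta_p P i))
    <= mean s (fun x => ((0 < block_hits f P x :> R) &&
                         (value_count f (-1) x z < m))%:R).
Proof.
move=> S_gt0 m_ge1 T_le z_gt0 nknk_le nkz_le error_le; rewrite prodf_div.
have nk_le : (n ^ k)%N%:R <= Q.
  by apply: le_trans nkz_le; rewrite ler_nat leq_pmulr.
have mean_ge := mean_block_hits_ge nk_le.
have mean_minus_le := mean_block_hits_minus_le nkz_le.
have mean_sqr_le := mean_sqr_block_hits_le nknk_le.
set H := \prod_i _ in error_le mean_ge mean_minus_le mean_sqr_le *.
set W := \prod_i (1 + _) in mean_sqr_le *.
set T := \sum_(p < z | prime p) _ in T_le mean_minus_le.
have error_ge0 : 0 <= Q * eps by rewrite mulr_ge0 // (le_trans _ nk_le).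
have H_gt0 : 0 < H by apply: prodr_gt0.
have W_ge1 : 1 <= W.
  rewrite /W; elim/big_ind: _ => // [x y x_ge1 y_ge1|i _].
    exact: mulr_ege1.
  by rewrite lerDl ltW.
have half_H_ge0 : 0 <= H / 2 by rewrite divr_ge0 // ltW.
have HW_gt0 : 0 < 2 * (H * W) by rewrite !mulr_gt0 // (lt_le_trans _ W_ge1).
have -> : 8^-1 * (H / W) = (H / 2) ^+ 2 / (2 * (H * W)).
  by field; rewrite !gt_eqF // (lt_le_trans _ W_ge1).
apply: second_moment_mean => //; try lra.
- exact: block_hits_ge0.
- by move=> x; apply: sumr_ge0.
- under eq_mean => x do rewrite mulrBr mulr1 mulrA [X in _ - X]mulrC.
  rewrite meanB meanZ; set B := mean s _ in mean_minus_le *.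
  have B_div_le : m^-1 * B <= H / 4 + Q * eps.
    rewrite ler_pdivrMl; last by lra.
    have HT_le : H * (4 * T) <= H * m by rewrite ler_pM2l.
    have error_le_m : Q * eps <= m * (Q * eps) by rewrite ler_peMl.
    lra.
  lra.
- have H_le_HW : H <= H * W by rewrite ler_peMr // ltW.
  lra.
Qed.

End TransversalMeans.

(** * Sums of f over primes *)

Section PartialSums.
Context {R : realType} {A : Type} (f : nat -> A -> int) (x : A).
Hypothesis f_val : forall p, f p x \in [:: -1; 0; 1].

Lemma fpartial_value_ind (n : nat) : fpartial f x n =
  value_count f 1 x n - value_count f (-1) x n :> R.
Proof.
rewrite /value_count -sumrB; apply: eq_bigr => p _; rewrite /value_ind.
by have := f_val p; rewrite !inE => /or3P[] /eqP ->;
  rewrite /= ?(subr0, sub0r, mulr1z, mulr0z, subrr, mulrN1z).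
Qed.

Lemma fpartial_ge (y z n : nat) : (y <= n)%N -> (z <= n)%N ->
  value_count f 1 x y - value_count f (-1) x z - #|large_support f x z n|%:R
    <= fpartial f x n :> R.
Proof.
move=> yn zn; rewrite fpartial_value_ind.
have plus_le : value_count f 1 x y <= value_count f 1 x n :> R.
  rewrite -subr_ge0 -(sum_ord_itv (n := n)) ?yn ?leqnn //.
  by apply: sumr_ge0 => p _; rewrite ler0n.
have minus_le : value_count f (-1) x n - value_count f (-1) x z <=
    #|large_support f x z n|%:R :> R.
  rewrite -(sum_ord_itv (n := n)) ?zn ?leqnn //.
  rewrite -sum1_card natr_sum big_mkcond [leRHS]big_mkcond.
  apply: ler_sum => p _.
  rewrite inE ltn_ord andbT /value_ind; case: (prime p) => //=.
  case: (leqP z p) => _; rewrite ?andbF ?andbT //.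
  by case: eqP => [->|_] //; case: ifP.
lra.
Qed.

Lemma fsum_ge_of_counts (y z : nat) (b t : R) :
  (forall n, #|large_support f x z n|%:R <= b) ->
  t <= value_count f 1 x y - value_count f (-1) x z - b ->
  fsum_ge f x t.
Proof.
move=> tail t_le; exists (maxn y z) => n; rewrite geq_max => /andP[yn zn].
by apply: le_trans (fpartial_ge yn zn); have := tail n; lra.
Qed.

End PartialSums.

Lemma expn_card_large_support_le (A : Type) (f : nat -> A -> int) (x : A)
  (n z : nat) :
  (z ^ #|large_support f x z n| <= support_prod f x n)%N.
Proof.
rewrite -prod_nat_const.
rewrite /support_prod [leqRHS](bigID (fun p : 'I_n => (z <= p)%N)) /=.
rewrite -[leqLHS]muln1; apply: leq_mul; last first.
  by apply: prodn_cond_gt0 => p /andP[/andP[/prime_gt0]].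
rewrite [leqRHS](eq_bigl [in large_support f x z n]) => [|p].
  by apply: leq_prod => p; rewrite inE => /and3P[].
by rewrite inE andbA.
Qed.

Lemma block_hits_gt0_le {R : realType} {A : Type} (f : nat -> A -> int) (x : A)
  (k n : nat) (P : 'I_k -> pred 'I_n) :
  prime_blocks P -> 0 < block_hits f P x :> R ->
  k%:R <= value_count f 1 x n :> R.
Proof.
move=> P_blocks; rewrite block_hits_transversals => hits_gt0.
have [t tP t_hits] : exists2 t : {ffun 'I_k -> 'I_n}, t \in family P &
    forall i, f (t i) x == 1.
  have [t /andP[tP]] := psumr_neq0P
    (fun t _ => prodr_ge0 _ (fun i _ => ler0n R _))
    (elimN eqP (lt0r_neq0 hits_gt0)).
  move/lt0r_neq0/prodf_neq0 => t_hits; exists t => // i.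
  by have := t_hits i isT; rewrite pnatr_eq0 eqb0 negbK.
have [P_prime _] := P_blocks; move/familyP: (tP) => tP_i.
rewrite -[k in k%:R]card_ord -(card_codom (transversal_inj P_blocks tP)).
rewrite -sum1_card natr_sum big_mkcond [leRHS]big_mkcond; apply: ler_sum => p _.
case: codomP => [[i ->]|_]; last by case: ifP.
by rewrite /value_ind (P_prime _ _ (tP_i i)) t_hits.
Qed.

Lemma prime_interval_blocks (c : nat -> nat) (k n : nat) :
  {homo c : i j / (i <= j)%N} ->
  prime_blocks (fun (i : 'I_k) (p : 'I_n) => prime p && (c i <= p < c i.+1)%N).
Proof.
move=> c_mono; split=> [i p /andP[]//|i j p].
move=> /andP[_ /andP[ip pi]] /andP[_ /andP[jp pj]]; apply: val_inj => /=.
have no_overlap a b : (a < b)%N -> (c b <= p)%N -> (p < c a.+1)%N -> False.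
  by move=> /c_mono ab bp /leq_trans /(_ ab); rewrite ltnNge bp.
by have [ij|ji|//] := ltngtP i j;
  [case: (no_overlap _ _ ij jp pi) | case: (no_overlap _ _ ji ip pj)].
Qed.

(** * Growth in log log N *)

Section Asymptotics.
Context {R : realType}.

Lemma linear_le_expR_near (a b c d : R) : 0 < c -> 0 < d ->
  \forall L \near +oo, a * L + b <= c * expR (d * L).
Proof.
move=> c_gt0 d_gt0; near=> L.
have L_ge1 : 1 <= L by near: L; apply: nbhs_pinfty_ge; exact: num_real.
have L_large : (`|a| + `|b|) * 2 / (c * d ^+ 2) <= L.
  by near: L; apply: nbhs_pinfty_ge; exact: num_real.
have L_ge0 : 0 <= L by lra.
have dL_ge0 : 0 <= d * L by rewrite mulr_ge0 // ltW.
have quadratic : c * ((d * L) ^+ 2 / 2) <= c * expR (d * L).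
  have : 1 + (d * L) ^+ 2 / 2 <= expR (d * L) := expR_ge1Dxn 1 dL_ge0.
  by rewrite ler_pM2l //; lra.
apply: le_trans quadratic.
have linear : a * L + b <= (`|a| + `|b|) * L.
  rewrite mulrDl lerD // ?ler_wpM2r ?ler_norm //.
  by rewrite (le_trans (ler_norm b)) // ler_peMr.
apply: le_trans linear _.
move: L_large; rewrite ler_pdivrMr ?mulr_gt0 ?exprn_gt0 // => L_large.
have : (`|a| + `|b|) * 2 * L <= L * (c * d ^+ 2) * L by rewrite ler_wpM2r.
rewrite exprMn; lra.
Unshelve. all: by end_near. Qed.

Lemma const_le_linear_near (a c : R) : 0 < c -> \forall L \near +oo, a <= c * L.
Proof.
move=> c_gt0; near=> L; suff ac_le : a / c <= L by rewrite mulrC -ler_pdivrMr.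
by near: L; apply: nbhs_pinfty_ge; exact: num_real.
Unshelve. all: by end_near. Qed.

Lemma const_le_expR_near (a c d : R) : 0 < c -> 0 < d ->
  \forall L \near +oo, a <= c * expR (d * L).
Proof.
move=> c_gt0 d_gt0; near=> L; have : 0 * L + a <= c * expR (d * L).
  by near: L; apply: linear_le_expR_near.
by rewrite mul0r add0r.
Unshelve. all: by end_near. Qed.

Lemma near_pinfty_expR_expR (P : R -> Prop) :
  (\forall L \near +oo, P (expR (expR L))) -> \forall N \near +oo, P N.
Proof.
case=> L0 [_ PL_near]; near=> N.
have N_large : expR (expR L0) < N.
  by near: N; apply: nbhs_pinfty_gt; exact: num_real.
have N_gt0 : 0 < N by apply: lt_trans N_large; apply: expR_gt0.
have lnN_large : expR L0 < ln N by rewrite -ltr_expR lnK.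
have lnN_gt0 : 0 < ln N by apply: lt_trans lnN_large; apply: expR_gt0.
rewrite -[N]lnK // -[ln N]lnK //; apply: PL_near.
by rewrite -ltr_expR lnK.
Unshelve. all: by end_near. Qed.

Lemma expR_expR_ge2 (L : R) : 0 <= L -> 2 <= expR (expR L).
Proof.
by move=> L_ge0; have := expR_ge1Dx (expR L); have := expR_ge1Dx L; lra.
Qed.

Lemma exists_nat_ge_le (x : R) : 0 <= x -> exists k : nat, x <= k%:R <= x + 1.
Proof.
move=> x_ge0; exists (Num.truncn x).+1.
by rewrite ltW ?truncnS_gt // -natr1 lerD2r truncn_le.
Qed.

Lemma exprn_ge_expR (r B L : R) (k : nat) :
  0 < r -> k%:R <= B * L -> expR (- (B * `|ln r|) * L) <= r ^+ k.
Proof.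
move=> r_gt0 k_le; rewrite -[r in leRHS]lnK // -expRM_natr ler_expR.
have : - ln r * k%:R <= `|ln r| * k%:R by rewrite ler_wpM2r // -normrN ler_norm.
have : `|ln r| * k%:R <= `|ln r| * (B * L) by rewrite ler_wpM2l.
lra.
Qed.

End Asymptotics.

(* For an integer p, p < cutoff y means p <= e^y. *)
Definition cutoff {R : realType} (y : R) : nat := (Num.truncn (expR y)).+1.

Definition mertens {R : realType} (eta : nat -> R) (c M K : R) : Prop :=
  forall N : R, 2 <= N -> `| psum eta N - c * ln (ln N) - M | <= K / ln N.

Section Cutoff.
Context {R : realType}.
Implicit Types x y : R.

Lemma le_cutoff x y : x <= y -> (cutoff x <= cutoff y)%N.
Proof. by move=> x_le_y; rewrite ltnS le_truncn // ler_expR. Qed.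

Lemma expR_le_cutoff y : expR y <= (cutoff y)%:R.
Proof. by rewrite ltW // truncnS_gt. Qed.

Lemma cutoff_le y : 0 <= y -> (cutoff y)%:R <= expR (y + 1).
Proof.
move=> y_ge0; rewrite -natr1 expRD.
have := expR_ge1Dx y; have := expR_ge1Dx (1 : R).
have : (Num.truncn (expR y))%:R <= expR y by rewrite truncn_le expR_ge0.
nra.
Qed.

End Cutoff.

(** * Prime blocks from Mertens' estimate *)

Section Mertens.
Context {R : realType} (eta : nat -> R) (c M K : R).
Hypothesis eta_mertens : mertens eta c M K.

Lemma mertens_expR (w : R) : 1 <= w ->
  `| \sum_(p < cutoff w | prime p) eta p - c * ln w - M | <= K / w.
Proof.
move=> w_ge1; have := eta_mertens (N := expR w); rewrite /psum expRK; apply.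
by have := expR_ge1Dx w; lra.
Qed.

Lemma mertens_block_ge (u a : R) : 0 <= u -> 0 <= a ->
  c * a - 2 * K / expR u <=
    \sum_(p < cutoff (expR (u + a)) | prime p) eta p -
    \sum_(p < cutoff (expR u) | prime p) eta p.
Proof.
move=> u_ge0 a_ge0; have u_le_ua : u <= u + a by rewrite lerDl.
have expR_ge1 w : u <= w -> 1 <= expR w.
  by move=> u_le_w; have := expR_ge1Dx w; lra.
have mertens_u := mertens_expR (expR_ge1 u (lexx u)).
have mertens_ua := mertens_expR (expR_ge1 _ u_le_ua).
rewrite !expRK in mertens_u mertens_ua.
have K_ge0 : 0 <= K.
  have := le_trans (normr_ge0 _) mertens_u.
  by rewrite pmulr_lge0 ?invr_gt0 ?expR_gt0.
have error_anti : K / expR (u + a) <= K / expR u.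
  by rewrite ler_wpM2l // lef_pV2 ?posrE ?expR_gt0 // ler_expR.
have := le_trans mertens_ua error_anti; move: mertens_u.
rewrite !ler_norml; lra.
Qed.

Lemma mertens_sum_le_near (b c' : R) : 0 < b -> c < c' ->
  \forall L \near +oo,
    \sum_(p < cutoff (b * expR L) | prime p) eta p <= c' * L.
Proof.
move=> b_gt0 cc'; near=> L.
have bE_ge1 : 1 <= b * expR L.
  rewrite -[in expR L](mul1r L).
  by near: L; apply: const_le_expR_near.
have const_le : c * ln b + M + `|K| <= (c' - c) * L.
  by near: L; apply: const_le_linear_near; rewrite subr_gt0.
have error_le : K / (b * expR L) <= `|K|.
  rewrite ler_pdivrMr; last by lra.
  by rewrite (le_trans (ler_norm K)) // ler_peMr.
have := mertens_expR bE_ge1; rewrite lnM ?posrE ?expR_gt0 // expRK ler_norml.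
by move=> /andP[_]; lra.
Unshelve. all: by end_near. Qed.

(* Each block fills an interval of length 1 / (4 B) for log log p inside
   [L / 4, L / 2], where the error term in Mertens' estimate is negligible. *)
Lemma mertens_prime_blocks (B : R) : 0 < c -> 0 < B ->
  exists2 sigma : R, 0 < sigma & \forall L \near +oo,
    forall k : nat, k%:R <= B * L ->
      exists2 P : 'I_k -> pred 'I_(cutoff (expR (L / 2))),
        prime_blocks P & forall i, sigma <= block_sum eta P i.
Proof.
move=> c_gt0 B_gt0; pose a := (4 * B)^-1.
have a_gt0 : 0 < a by rewrite invr_gt0 mulr_gt0.
exists (c * a / 2); first by rewrite !mulr_gt0.
near=> L => k k_le.
have L_ge0 : 0 <= L by near: L; apply: nbhs_pinfty_ge; exact: num_real.
have error_le : 4 * K <= c * a * expR (L / 4).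
  rewrite [L / 4]mulrC.
  by near: L; apply: const_le_expR_near; rewrite ?mulr_gt0.
pose u (i : nat) := L / 4 + i%:R * a; pose cut i := cutoff (expR (u i)).
have cut_mono : {homo cut : i j / (i <= j)%N}.
  by move=> i j ij; rewrite le_cutoff // ler_expR lerD2l ler_pM2r ?ler_nat.
have uk_le : u k <= L / 2.
  have : k%:R * a <= B * L * a by rewrite ler_pM2r.
  have -> : B * L * a = L / 4 by rewrite /a; field; rewrite gt_eqF.
  by rewrite /u; lra.
exists (fun i p => prime p && (cut i <= p < cut i.+1)%N) => [|i].
  exact: prime_interval_blocks.
have cut_le : (cut i <= cut i.+1 <= cutoff (expR (L / 2)))%N.
  rewrite cut_mono //; apply: leq_trans (cut_mono _ _ (ltn_ord i)) _.
  by rewrite le_cutoff // ler_expR.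
rewrite /block_sum (sum_ord_itv prime eta cut_le).
have ui_ge : L / 4 <= u i by rewrite lerDl mulr_ge0 // ltW.
have -> : cut i.+1 = cutoff (expR (u i + a)).
  by rewrite /cut /u -[i.+1%:R]natr1 mulrDl mul1r addrA.
apply: le_trans (mertens_block_ge _ (ltW a_gt0)); last by lra.
have error_at_ui : c * a * expR (L / 4) <= c * a * expR (u i).
  by rewrite ler_pM2l ?mulr_gt0 // ler_expR.
have : 2 * K / expR (u i) <= c * a / 2.
  by rewrite ler_pdivrMr ?expR_gt0 //; lra.
lra.
Unshelve. all: by end_near. Qed.

End Mertens.

(** * Range and error of the sieve *)

Section SieveRange.
Context {R : realType}.

Lemma cutoff_expn_le_near (b B : R) : 0 < b -> 0 < B ->
  \forall L \near +oo, forall k : nat, k%:R <= B * L ->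
    ((cutoff (expR (L / 2))) ^ k)%N%:R <= expR (b * expR L).
Proof.
move=> b_gt0 B_gt0; near=> L => k k_le.
have L_ge0 : 0 <= L by near: L; apply: nbhs_pinfty_ge; exact: num_real.
have BL_le : 2 * B * L <= b * expR (L / 2).
  rewrite -[leLHS]addr0 [L / 2]mulrC.
  by near: L; apply: linear_le_expR_near.
set h := expR (L / 2) in BL_le *.
have h_ge1 : 1 <= h by have := expR_ge1Dx (L / 2); rewrite -/h; lra.
have sqr_h : h * h = expR L by rewrite -expRD; congr expR; lra.
have h_ge0 : 0 <= h by lra.
rewrite natrX; apply: le_trans (_ : expR (h + 1) ^+ k <= _).
  by rewrite lerXn2r ?nnegrE ?expR_ge0 // cutoff_le.
rewrite -expRM_natl ler_expR -sqr_h.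
have : k%:R * (h + 1) <= B * L * (2 * h) by rewrite ler_pM //; lra.
have : 2 * B * L * h <= b * h * h by rewrite ler_wpM2r.
lra.
Unshelve. all: by end_near. Qed.

Lemma sieve_range_near (xi B : R) : 0 < xi -> 0 < B ->
  \forall L \near +oo, forall k : nat, k%:R <= B * L ->
    (cutoff (expR (L / 2)) ^ k * cutoff (expR (L / 2)) ^ k)%N%:R
      <= expR (xi / 2 * expR L) /\
    (cutoff (expR (L / 2)) ^ k * cutoff (xi / 4 * expR L))%N%:R
      <= expR (xi / 2 * expR L).
Proof.
move=> xi_gt0 B_gt0; have xi8_gt0 : 0 < xi / 8 by lra.
near=> L.
have expn_le : forall k : nat, k%:R <= B * L ->
    ((cutoff (expR (L / 2))) ^ k)%N%:R <= expR (xi / 8 * expR L).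
  by near: L; apply: cutoff_expn_le_near.
move=> k /expn_le; set n := cutoff (expR (L / 2)) => nk_le.
have xiE_ge8 : 8 <= xi * expR L.
  rewrite -[in expR L](mul1r L).
  by near: L; apply: const_le_expR_near.
have xiE_ge0 : 0 <= xi * expR L by lra.
have z_le : (cutoff (xi / 4 * expR L))%:R <= expR (3 / 8 * (xi * expR L)).
  by apply: le_trans (cutoff_le _) _; rewrite ?ler_expR; lra.
split; rewrite natrM.
  apply: le_trans (ler_pM (ler0n _ _) (ler0n _ _) nk_le nk_le) _.
  by rewrite -expRD ler_expR; lra.
apply: le_trans (ler_pM (ler0n _ _) (ler0n _ _) nk_le z_le) _.
by rewrite -expRD ler_expR; lra.
Unshelve. all: by end_near. Qed.

Lemma sieve_error_near (xi B K sigma : R) : 0 < xi -> 0 < sigma ->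
  \forall L \near +oo, forall k : nat, k%:R <= B * L ->
    8 * (expR (xi / 2 * expR L) * (K * expR (- xi * expR L))) <= sigma ^+ k.
Proof.
move=> xi_gt0 sigma_gt0; near=> L => k k_le.
apply: le_trans (exprn_ge_expR sigma_gt0 k_le).
have exponent_le : B * `|ln sigma| * L + 8 * K <= xi / 2 * expR (1 * L).
  by near: L; apply: linear_le_expR_near => //; lra.
rewrite [X in 8 * X]mulrCA -expRD mulrA.
apply: le_trans (_ : expR (8 * K) * expR (- (xi / 2 * expR L)) <= _).
  have -> : xi / 2 * expR L + - xi * expR L = - (xi / 2 * expR L) by lra.
  by rewrite ler_pM2r ?expR_gt0 //; have := expR_ge1Dx (8 * K); lra.
by rewrite -expRD ler_expR; rewrite mul1r in exponent_le; lra.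
Unshelve. all: by end_near. Qed.

Lemma card_large_support_le_near (A : Type) (f : nat -> A -> int) (b C K : R) :
  0 < b -> \forall L \near +oo, forall (x : A) (n : nat),
    (support_prod f x n)%:R <= K * expR (C * expR L) ->
    #|large_support f x (cutoff (b * expR L)) n|%:R <= L.
Proof.
move=> b_gt0; near=> L => x n support_le.
have := expn_card_large_support_le f x n (cutoff (b * expR L)).
rewrite -(ler_nat R) => /le_trans /(_ support_le); move: #|_| => j {support_le}.
have L_ge0 : 0 <= L by near: L; apply: nbhs_pinfty_ge; exact: num_real.
have E_ge1 : 1 <= expR L by have := expR_ge1Dx L; lra.
have const_le : `|K| + C <= b * L.
  by near: L; apply: const_le_linear_near.
have lower : expR (b * expR L * j%:R) <= (cutoff (b * expR L) ^ j)%N%:R.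
  by rewrite natrX expRM_natr lerXn2r ?nnegrE ?expR_ge0 // expR_le_cutoff.
have upper : K * expR (C * expR L) <= expR (`|K| + C * expR L).
  rewrite expRD ler_pM2r ?expR_gt0 //.
  by have := expR_ge1Dx `|K|; have := ler_norm K; lra.
move=> /(le_trans lower) /le_trans /(_ upper); rewrite ler_expR => bEj_le.
have bE_gt0 : 0 < b * expR L by rewrite mulr_gt0 ?expR_gt0.
rewrite -(ler_pM2l bE_gt0) (le_trans bEj_le) //.
have : (`|K| + C) * expR L <= b * L * expR L by rewrite ler_wpM2r // ltW.
have : `|K| * 1 <= `|K| * expR L by rewrite ler_wpM2l.
lra.
Unshelve. all: by end_near. Qed.

End SieveRange.

(** * Proportion of large sums *)

Lemma mean_many_plus_few_minus {R : realType} {A : Type} (f : nat -> A -> int)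
  (s : seq A) (eta_m eta_p : nat -> R) (Q eps m sigma : R) (k n z : nat)
  (P : 'I_k -> pred 'I_n) :
  mult01 eta_m -> mult01 eta_p -> equidistributed f s eta_m eta_p Q eps ->
  prime_blocks P -> 0 < sigma ->
  (forall i, sigma <= block_sum eta_p P i) ->
  1 <= m -> 4 * \sum_(p < z | prime p) eta_m p <= m -> (0 < z)%N -> 1 <= Q ->
  (n ^ k * n ^ k)%N%:R <= Q -> (n ^ k * z)%N%:R <= Q ->
  8 * (Q * eps) <= sigma ^+ k ->
  8^-1 * (sigma / (1 + sigma)) ^+ k <=
    mean s (fun x => ((k%:R <= value_count f 1 x n :> R) &&
                      (value_count f (-1) x z < m))%:R).
Proof.
move=> m_mult p_mult equi P_blocks sigma_gt0 sums_ge m_ge1 T_le z_gt0 Q_ge1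
  nknk_le nkz_le error_le.
have eps_ge0 := equidistributed_ge0 equi Q_ge1.
have sums_gt0 i : 0 < block_sum eta_p P i by apply: lt_le_trans (sums_ge i).
have error_le_prod : 8 * (Q * eps) <= \prod_(i < k) block_sum eta_p P i.
  by apply: le_trans error_le _; apply: exprn_le_prod => //; apply: ltW.
apply: (@le_trans _ _
  (8^-1 * \prod_(i < k) (block_sum eta_p P i / (1 + block_sum eta_p P i)))).
  rewrite ler_pM2l //; apply: exprn_le_prod => [|i].
    by rewrite divr_ge0; lra.
  have := sums_ge i; move: (block_sum _ _ _) => S_i S_i_ge.
  by rewrite ler_pdivrMr; last lra; rewrite mulrAC ler_pdivlMr; lra.
apply: le_trans (mean_block_hits_few_minus m_mult p_mult equi eps_ge0 P_blocks
  sums_gt0 m_ge1 T_le z_gt0 nknk_le nkz_le error_le_prod) _.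
apply: le_mean_pred => x.
by move=> /andP[/(block_hits_gt0_le P_blocks) -> ->].
Qed.

Section Proportion.
Context {R : realType} {A : eqType} (AN : R -> seq A) (f : nat -> A -> int).
Variables (eta_m eta_p : nat -> R) (xi K c_m M_m K_m c_p M_p K_p : R).
Hypotheses (xi_gt0 : 0 < xi) (c_m_gt0 : 0 < c_m) (c_p_gt0 : 0 < c_p).
Hypotheses (eta_m_mult : mult01 eta_m) (eta_p_mult : mult01 eta_p).
Hypothesis equi : forall N : R, 2 <= N ->
  equidistributed f (AN N) eta_m eta_p (N `^ (xi / 2)) (K * N `^ (- xi)).
Hypotheses (eta_m_mertens : mertens eta_m c_m M_m K_m)
           (eta_p_mertens : mertens eta_p c_p M_p K_p).

Lemma equidistributed_expR (L : R) : 0 <= L ->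
  equidistributed f (AN (expR (expR L))) eta_m eta_p
    (expR (xi / 2 * expR L)) (K * expR (- xi * expR L)).
Proof.
move=> L_ge0; rewrite [xi / 2 * _]mulrC [- xi * _]mulrC !expRM.
exact/equi/expR_expR_ge2.
Qed.

Lemma mean_many_plus_few_minus_near (B : R) : 0 < B ->
  exists2 delta : R, 0 < delta & \forall L \near +oo,
    8^-1 * expR (- delta * L) <= mean (AN (expR (expR L))) (fun x =>
      ((B * L <= value_count f 1 x (cutoff (expR (L / 2)))) &&
       (value_count f (-1) x (cutoff (xi / 4 * expR L)) <
          4 * (c_m + 1) * L))%:R).
Proof.
move=> B_gt0; have B1_gt0 : 0 < B + 1 by lra.
have [sigma sigma_gt0 blocks] :=
  mertens_prime_blocks eta_p_mertens c_p_gt0 B1_gt0.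
pose r := sigma / (1 + sigma).
have [r_gt0 r_lt1] : 0 < r /\ r < 1.
  by rewrite divr_gt0 ?ltr_pdivrMr ?mul1r; lra.
exists ((B + 1) * `|ln r|).
  by rewrite mulr_gt0 // normr_gt0 lt_eqF // ln_lt0 // r_gt0.
near=> L.
have L_ge1 : 1 <= L by near: L; apply: nbhs_pinfty_ge; exact: num_real.
have BL_ge0 : 0 <= B * L by apply: mulr_ge0; lra.
have [k /andP[k_ge k_le1]] := exists_nat_ge_le BL_ge0.
have k_le : k%:R <= (B + 1) * L by lra.
have [//|P P_blocks P_ge] := near blocks L _ k k_le.
have [//|nknk_le nkz_le] := near (sieve_range_near xi_gt0 B1_gt0) L _ k k_le.
have error_le : 8 * (expR (xi / 2 * expR L) * (K * expR (- xi * expR L)))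
    <= sigma ^+ k.
  exact: (near (sieve_error_near (B + 1) K xi_gt0 sigma_gt0) L _ k k_le).
have few : \sum_(p < cutoff (xi / 4 * expR L) | prime p) eta_m p
    <= (c_m + 1) * L.
  near: L; apply: (mertens_sum_le_near eta_m_mertens _ (c' := c_m + 1)).
    by rewrite divr_gt0.
  by rewrite ltrDl.
apply: le_trans (_ : 8^-1 * r ^+ k <= _).
  by rewrite ler_pM2l ?exprn_ge_expR.
apply: le_trans (mean_many_plus_few_minus (m := 4 * (c_m + 1) * L)
  eta_m_mult eta_p_mult (equidistributed_expR _) P_blocks sigma_gt0 P_ge
  _ _ _ _ nknk_le nkz_le error_le) _ => //.
- by have : 0 <= c_m * L by [rewrite mulr_ge0 ?(ltW c_m_gt0) //; lra]; lra.
- lra.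
- by rewrite -expR0 ler_expR mulr_ge0 ?expR_ge0 ?divr_ge0 ?ltW.
by apply: le_mean_pred => x /andP[/(le_trans k_ge) -> ->].
Unshelve. all: by end_near. Qed.

Hypothesis f_val : forall p x, f p x \in [:: -1; 0; 1].
Variables C K_s : R.
Hypothesis support_bound : forall N : R, 2 <= N -> forall x : A, x \in AN N ->
  forall n : nat, (support_prod f x n)%:R <= K_s * N `^ C.

Lemma mean_fsum_ge_near (A0 : R) : 0 < A0 ->
  exists2 delta : R, 0 < delta & \forall N \near +oo,
    8^-1 * ln N `^ (- delta) <=
      mean (AN N) (fun x => `[< fsum_ge f x (A0 * ln (ln N)) >]%:R).
Proof.
move=> A0_gt0; have B_gt0 : 0 < A0 + 4 * (c_m + 1) + 1.
  by rewrite !addr_gt0 ?mulr_gt0 ?addr_gt0.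
have [delta delta_gt0 many] := mean_many_plus_few_minus_near B_gt0.
exists delta => //; apply: near_pinfty_expR_expR; near=> L.
rewrite !expRK -expRM [L * _]mulrC.
have L_ge0 : 0 <= L by near: L; apply: nbhs_pinfty_ge; exact: num_real.
have tail : forall (x : A) (n : nat),
    (support_prod f x n)%:R <= K_s * expR (C * expR L) ->
    #|large_support f x (cutoff (xi / 4 * expR L)) n|%:R <= L.
  by near: L; apply: card_large_support_le_near; rewrite divr_gt0.
apply: le_trans (near many L _) _ => //.
apply: le_mean_pred_in => x xN /andP[plus minus]; apply/asboolP.
apply: (fsum_ge_of_counts (f_val^~ x) _ (b := L)) => [n|].
  apply: tail; rewrite [C * _]mulrC expRM; apply: support_bound => //.
  exact: expR_expR_ge2.
lra.
Unshelve. all: by end_near. Qed.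

End Proportion.

Theorem theorem5p3 (R : realType) (A : eqType) (h : A -> R)
  (AN : R -> seq A) (f : nat -> A -> int) (eta_m eta_p : nat -> R)
  (xi c_p c_m C M_p M_m : R)
  (* A is infinite *)
  (Ainf : forall s : seq A, exists x : A, x \notin s)
  (* A(N) = the finite set of elements of height at most N *)
  (ANuniq : forall N : R, uniq (AN N))
  (ANmem : forall (N : R) (x : A), (x \in AN N) = (h x <= N))
  (* log |A(N)| asymp log N *)
  (Agrowth : exists c1 c2 N1 : R, 0 < c1 /\ 0 < c2 /\
     forall N : R, N1 <= N ->
       c1 * ln N <= ln (size (AN N))%:R <= c2 * ln N)
  (* f_p takes values in {-1,0,1} *)
  (fval : forall (p : nat) (x : A), f p x \in [:: -1; 0; 1])
  (xipos : 0 < xi)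
  (eta_m_mult : mult01 eta_m) (eta_p_mult : mult01 eta_p)
  (* equidistribution *)
  (equi : exists K : R, forall N : R, 2 <= N ->
     forall qm qp : nat, squarefree qm -> squarefree qp -> coprime qm qp ->
       ((qm * qp)%N%:R <= N `^ (xi / 2)) ->
       `| (count_sieve f (AN N) qm qp)%:R / (size (AN N))%:R
          - eta_m qm * eta_p qp | <= K * N `^ (- xi))
  (cppos : 0 < c_p) (cmpos : 0 < c_m) (Cpos : 0 < C)
  (eta_p_small : exists K : R, forall p : nat, prime p -> eta_p p <= K / p%:R)
  (eta_m_small : exists K : R, forall p : nat, prime p -> eta_m p <= K / p%:R)
  (eta_p_mertens : exists K : R, forall N : R, 2 <= N ->
     `| psum eta_p N - c_p * ln (ln N) - M_p | <= K / ln N)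
  (eta_m_mertens : exists K : R, forall N : R, 2 <= N ->
     `| psum eta_m N - c_m * ln (ln N) - M_m | <= K / ln N)
  (* max_{x in A(N)} prod_{p : f_p(x) <> 0} p << N^C *)
  (suppbound : exists K : R, forall N : R, 2 <= N ->
     forall x : A, x \in AN N ->
       forall n : nat, (\prod_(p < n | prime p && (f p x != 0)) p)%N%:R
                       <= K * N `^ C) :
  forall A0 : R, 0 < A0 ->
    exists delta : R, 0 < delta /\
    exists (c N0 : R), 0 < c /\
      forall N : R, N0 <= N -> 2 <= N ->
        c * (size (AN N))%:R * (ln N) `^ (- delta)
          <= (count (fun x => `[< fsum_ge f x (A0 * ln (ln N)) >]) (AN N))%:R.
Proof.
move=> A0 A0_gt0; have [K_e equiK] := equi; have [K_s suppK] := suppbound.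
have [K_m mertens_m] := eta_m_mertens; have [K_p mertens_p] := eta_p_mertens.
have [delta delta_gt0 often] := mean_fsum_ge_near xipos cmpos cppos eta_m_mult
  eta_p_mult equiK mertens_m mertens_p fval suppK A0_gt0.
exists delta; split => //; exists 8^-1.
have [N0 [_ boundN]] := often; exists (N0 + 1); split=> // N N0N _.
rewrite -mulr_size_mean_pred mulrAC mulrC ler_wpM2l // boundN //; lra.
Qed.
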